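(* Let $R=\mathbb Z_N[\mathbb Z^D]$, let $\mathbf f=(f_1,\dots,f_s)$ be a regular sequence in $R$, let $\mathbf L=(L_1,\dots,L_D)\in\mathbb Z_{>0}^D$, and set $\mathbf b:=(x_1^{L_1}-1,\dots,x_D^{L_D}-1)$, $S:=R/(\mathbf f)$, $R_{\mathbf L}:=R/(\mathbf b)$. Then the $Z$-logical module in degree $j$ satisfies $$\mathcal H_j^Z(\mathbf L)\;\cong_{R_{\mathbf L}}\;\operatorname{Tor}_j^R\bigl(R/(\mathbf b),R/(\mathbf f)\bigr)\;\cong_{R_{\mathbf L}}\;H_j\bigl(K_\bullet(\mathbf b;S)\bigr).$$
   Context: $R=\mathbb Z_N[x_1^{\pm1},\dots,x_D^{\pm1}]$. A sequence $(f_1,\dots,f_s)$ is regular if $f_1$ is a non-zero-divisor in $R$ and each $f_i$ ($2\le i\le s$) is a non-zero-divisor on $R/(f_1,\dots,f_{i-1})$. For any finite sequence $\mathbf g=(g_1,\dots,g_r)$ in $R$, the Koszul complex $K_\bullet(\mathbf g)$ has $K_i(\mathbf g)=\bigwedge^iR^r$, $\partial_i(e_{a_1}\wedge\cdots\wedge e_{a_i})=\sum_{k=1}^i(-1)^{k-1}g_{a_k}e_{a_1}\wedge\cdots\widehat{e_{a_k}}\cdots\wedge e_{a_i}$, and $K_\bullet(\mathbf g;M):=K_\bullet(\mathbf g)\otimes_RM$ for an $R$-module $M$. The $Z$-logical module of the degree-$j$ periodic Koszul-complex code of size $\mathbf L$ ($0\le j\le s$) is $\mathcal H_j^Z(\mathbf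 L):=H_j\bigl(K_\bullet(\mathbf f;R_{\mathbf L})\bigr)$. (The homology $H_j(K_\bullet(\mathbf b;S))$ is annihilated by $\mathbf b$, hence is an $R_{\mathbf L}$-module.) *)

(* Defs.v *)
From HB Require Import structures.
From mathcomp Require Import all_boot all_order all_algebra.
From mathcomp Require Import generic_quotient ring.
From mathcomp.classical Require Import boolp.
From mathcomp.multinomials Require Import freeg.

Set Implicit Arguments.
Unset Strict Implicit.
Unset Printing Implicit Defensive.

Import GRing.Theory.
Local Open Scope ring_scope.
Local Open Scope quotient_scope.

(* Quotient M / <P> of a module by the submodule generated by a predicate P. *)
Section Quotient.
Variables (R : pzRingType) (M : lmodType R) (P : M -> Prop).

Inductive span : M -> Prop :=
| span0 : span 0
| spanD a x y : P x -> span y -> span (a *: x + y).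

Lemma span_add x y : span x -> span y -> span (x + y).
Proof.
by elim=> [|a u v Pu _ IH] Sy; rewrite ?add0r // -addrA; apply: spanD; auto.
Qed.

Lemma span_scale a x : span x -> span (a *: x).
Proof.
elim=> [|b u v Pu _ IH]; first by rewrite scaler0; apply: span0.
by rewrite scalerDr scalerA; apply: spanD.
Qed.

Lemma span_opp x : span x -> span (- x).
Proof. by rewrite -scaleN1r; apply: span_scale. Qed.

Lemma span_gen x : P x -> span x.
Proof. by move=> Px; rewrite -[x]addr0 -[x]scale1r; apply/spanD/span0. Qed.

Definition quo_eq (x y : M) : bool := `[< span (x - y) >].

Lemma quo_eq_refl : reflexive quo_eq.
Proof. by move=> x; apply/asboolP; rewrite subrr; apply: span0. Qed.

Lemma quo_eq_sym : symmetric quo_eq.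
Proof.
by move=> x y; apply/asboolP/asboolP => /span_opp; rewrite opprB.
Qed.

Lemma quo_eq_trans : transitive quo_eq.
Proof.
move=> y x z /asboolP Sxy /asboolP Syz; apply/asboolP.
by rewrite -(subrK y x) -addrA; apply: span_add.
Qed.

Canonical quo_equiv := EquivRel quo_eq quo_eq_refl quo_eq_sym quo_eq_trans.

Definition quo := {eq_quot quo_eq}.
HB.instance Definition _ := Choice.on quo.
HB.instance Definition _ := EqQuotient.on quo.

Lemma quo_eqP x y : (\pi_quo x = \pi_quo y) <-> span (x - y).
Proof.
split=> [/eqP|Sxy]; first by rewrite eqmodE => /asboolP.
by apply/eqP; rewrite eqmodE; apply/asboolP.
Qed.

Lemma span_repr x : span (repr (\pi_quo x) - x).
Proof. by apply/quo_eqP; rewrite reprK. Qed.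

Lemma quoW (T : quo -> Prop) : (forall x, T (\pi_quo x)) -> forall u, T u.
Proof. by move=> H u; rewrite -(reprK u). Qed.

Definition quo_zero : quo := \pi_quo 0.
Definition quo_add (u v : quo) : quo := \pi_quo (repr u + repr v).
Definition quo_opp (u : quo) : quo := \pi_quo (- repr u).
Definition quo_scale (a : R) (u : quo) : quo := \pi_quo (a *: repr u).

Lemma pi_quo_add x y : \pi_quo (x + y) = quo_add (\pi_quo x) (\pi_quo y).
Proof.
apply/esym/quo_eqP; rewrite opprD addrACA.
by apply: span_add; apply: span_repr.
Qed.

Lemma pi_quo_opp x : \pi_quo (- x) = quo_opp (\pi_quo x).
Proof.
by apply/esym/quo_eqP; rewrite -opprD; apply/span_opp/span_repr.
Qed.

Lemma pi_quo_scale a x : \pi_quo (a *: x) = quo_scale a (\pi_quo x).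
Proof.
by apply/esym/quo_eqP; rewrite -scalerBr; apply/span_scale/span_repr.
Qed.

Lemma quo_addA : associative quo_add.
Proof.
apply: quoW => x; apply: quoW => y; apply: quoW => z.
by rewrite -!pi_quo_add addrA.
Qed.

Lemma quo_addC : commutative quo_add.
Proof. by apply: quoW => x; apply: quoW => y; rewrite -!pi_quo_add addrC. Qed.

Lemma quo_add0 : left_id quo_zero quo_add.
Proof. by apply: quoW => x; rewrite -pi_quo_add add0r. Qed.

Lemma quo_addN : left_inverse quo_zero quo_opp quo_add.
Proof. by apply: quoW => x; rewrite -pi_quo_opp -pi_quo_add addNr. Qed.

HB.instance Definition _ := GRing.isZmodule.Build quo
  quo_addA quo_addC quo_add0 quo_addN.

Lemma quo_scaleA a b u : quo_scale a (quo_scale b u) = quo_scale (a * b) u.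
Proof. by move: u; apply: quoW => x; rewrite -!pi_quo_scale scalerA. Qed.

Lemma quo_scale1 : left_id 1 quo_scale.
Proof. by apply: quoW => x; rewrite -pi_quo_scale scale1r. Qed.

Lemma quo_scaleDr : right_distributive quo_scale +%R.
Proof.
move=> a; apply: quoW => x; apply: quoW => y.
by rewrite -[LHS]/(quo_scale _ (quo_add _ _)) -pi_quo_add -!pi_quo_scale
           scalerDr pi_quo_add.
Qed.

Lemma quo_scaleDl u : {morph quo_scale^~ u : a b / a + b}.
Proof.
by move=> a b; move: u; apply: quoW => x; rewrite -!pi_quo_scale scalerDl pi_quo_add.
Qed.

HB.instance Definition _ := GRing.Zmodule_isLmodule.Build R quo
  quo_scaleA quo_scale1 quo_scaleDr quo_scaleDl.

Definition qproj (x : M) : quo := \pi_quo x.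

Lemma qproj_is_linear : linear qproj.
Proof. by move=> a x y; rewrite /qproj pi_quo_add pi_quo_scale. Qed.

HB.instance Definition _ := GRing.isLinear.Build R M quo *:%R qproj
  qproj_is_linear.

Lemma qprojP x y : (qproj x = qproj y) <-> span (x - y).
Proof. exact: quo_eqP. Qed.

Lemma qproj_gen x : P x -> qproj x = 0.
Proof.
by move=> Px; rewrite -(linear0 qproj); apply/qprojP; rewrite subr0; apply: span_gen.
Qed.

Lemma qprojK (u : quo) : qproj (repr u) = u.
Proof. exact: reprK. Qed.

Lemma qprojW (T : quo -> Prop) : (forall x, T (qproj x)) -> forall u, T u.
Proof. by move=> H u; rewrite -(qprojK u). Qed.

End Quotient.

Section QuotientLift.
Variables (R : pzRingType) (M M' : lmodType R) (P : M -> Prop).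
Variable f : {linear M -> M'}.
Hypothesis fP : forall x, P x -> f x = 0.

Definition qlift of (forall x, P x -> f x = 0) :=
  fun u : quo P => f (repr u).

Lemma span_lift x : span P x -> f x = 0.
Proof.
by elim=> [|a y z Py _ IH]; rewrite ?linear0 // linearP fP // IH scaler0 add0r.
Qed.

Lemma qliftE x : qlift fP (qproj P x) = f x.
Proof.
by apply/eqP; rewrite -subr_eq0 -linearB; apply/eqP/span_lift/span_repr.
Qed.

Lemma qlift_is_linear : linear (qlift fP).
Proof.
move=> a; apply: qprojW => x; apply: qprojW => y.
by rewrite -linearP !qliftE linearP.
Qed.

HB.instance Definition _ := GRing.isLinear.Build R (quo P) M' *:%R (qlift fP)
  qlift_is_linear.
End QuotientLift.

(* The quotient ring R/(s); it may be the zero ring. *)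
Section QuotientRing.
Variables (R : comPzRingType) (s : seq R).

Definition qring := quo (fun x : R^o => x \in s).
HB.instance Definition _ := GRing.Lmodule.on qring.

Let pi (x : R) : qring := qproj _ (x : R^o).

Definition qring_one : qring := pi 1.
Definition qring_mul (u v : qring) : qring := pi ((repr u : R) * (repr v : R)).

Lemma pi_qring_mul (x y : R) : pi (x * y) = qring_mul (pi x) (pi y).
Proof.
apply/esym/qprojP.
set u := (repr (pi x) : R); set v := (repr (pi y) : R).
have -> : (u * v : R^o) - x * y = v *: (u - x : R^o) + x *: (v - y : R^o).
  by rewrite /GRing.scale /= !mulrBr [v * u]mulrC [v * x]mulrC addrA subrK.
by apply: span_add; apply: span_scale; apply: span_repr.
Qed.

Lemma qringW (T : qring -> Prop) : (forall x, T (pi x)) -> forall u, T u.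
Proof. by move=> H u; rewrite -(qprojK u); apply: H. Qed.

Lemma qring_mulA : associative qring_mul.
Proof.
by apply: qringW => x; apply: qringW => y; apply: qringW => z;
  rewrite -!pi_qring_mul mulrA.
Qed.

Lemma qring_mulC : commutative qring_mul.
Proof.
by apply: qringW => x; apply: qringW => y; rewrite -!pi_qring_mul mulrC.
Qed.

Lemma qring_mul1 : left_id qring_one qring_mul.
Proof. by apply: qringW => x; rewrite -pi_qring_mul mul1r. Qed.

Lemma qring_mulDl : left_distributive qring_mul +%R.
Proof.
apply: qringW => x; apply: qringW => y; apply: qringW => z.
by rewrite -[pi x + pi y]linearD -!pi_qring_mul mulrDl [LHS]linearD.
Qed.

HB.instance Definition _ := GRing.Zmodule_isComPzRing.Build qring
  qring_mulA qring_mulC qring_mul1 qring_mulDl.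
End QuotientRing.

(* An R-module X killed by the ideal (s) is an R/(s)-module. *)
Definition annihilated (R : comPzRingType) (s : seq R) (X : lmodType R) : Prop :=
  forall a (x : X), a \in s -> a *: x = 0.

Section AnnihilatedModule.
Variables (R : comPzRingType) (s : seq R) (X : lmodType R).
Hypothesis sX : annihilated s X.

Definition annmod of annihilated s X : Type := X.
HB.instance Definition _ := GRing.Zmodule.on (annmod sX).

(* Independent of the representative, by ann_scaleE below. *)
Definition ann_scale (q : qring s) (x : annmod sX) : annmod sX :=
  (repr q : R) *: (x : X).

Lemma ann_span (a : R^o) (x : X) :
  span (fun y : R^o => y \in s) a -> (a : R) *: x = 0.
Proof.
elim=> [|b y z sy _ IH]; first exact: scale0r.
by rewrite scalerDl IH addr0 -scalerA (sX x sy) scaler0.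
Qed.

Lemma ann_scaleE (a : R) (x : annmod sX) :
  ann_scale (qproj _ (a : R^o)) x = a *: (x : X).
Proof.
apply/eqP; rewrite -subr_eq0 -scalerBl; apply/eqP.
exact: (ann_span (a := repr (qproj _ (a : R^o)) - a)) (span_repr _ _).
Qed.

Lemma ann_scaleA p q x : ann_scale p (ann_scale q x) = ann_scale (p * q) x.
Proof.
elim/qringW: p => a; elim/qringW: q => b.
by rewrite -[_ * _]pi_qring_mul !ann_scaleE scalerA.
Qed.

Lemma ann_scale1 : left_id 1 ann_scale.
Proof. by move=> x; rewrite ann_scaleE scale1r. Qed.

Lemma ann_scaleDr : right_distributive ann_scale +%R.
Proof. by move=> q x y; rewrite /ann_scale scalerDr. Qed.

Lemma ann_scaleDl x : {morph ann_scale^~ x : p q / p + q}.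
Proof.
apply: qringW => a; apply: qringW => b.
by rewrite -linearD !ann_scaleE scalerDl.
Qed.

HB.instance Definition _ := GRing.Zmodule_isLmodule.Build (qring s) (annmod sX)
  ann_scaleA ann_scale1 ann_scaleDr ann_scaleDl.
End AnnihilatedModule.

Definition isom (R : pzRingType) (X Y : lmodType R) : Prop :=
  exists f : {linear X -> Y}, bijective f.

Section FreeModule.
Variables (R : nzRingType) (K : choiceType) (M : lmodType R) (h : K -> M).

Lemma freegUZ (a b : R) (k : K) : a *: << b *g k >> = << a * b *g k >>.
Proof. by apply/eqP/freeg_eqP => x; rewrite coeffZ !coeffU mulrA. Qed.

Lemma fglift_is_linear : linear (fglift h).
Proof.
have fB : {morph fglift h : x y / x - y} := lift_is_additive h.
have f0 : fglift h 0 = 0 by rewrite -(subrr 0) fB subrr.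
have fD : {morph fglift h : x y / x + y}.
  by move=> x y; rewrite -[y in LHS]opprK fB -[- y]add0r fB f0 add0r opprK.
move=> a x y; rewrite fD; congr (_ + _).
rewrite -[x]freeg_sumE scaler_sumr !(big_morph _ fD f0) scaler_sumr.
by apply: eq_bigr => k _; rewrite freegUZ !liftU scalerA.
Qed.

HB.instance Definition _ := GRing.isLinear.Build R {freeg K / R} M *:%R
  (fglift h) fglift_is_linear.

Lemma fgliftU (k : K) : fglift h << k >> = h k.
Proof. by rewrite liftU scale1r. Qed.

Lemma free_ind (T : {freeg K / R} -> Prop) :
  T 0 -> (forall a k x, T x -> T (a *: << k >> + x)) -> forall x, T x.
Proof.
move=> T0 TD x; rewrite -[x]freeg_sumE; elim: (dom x) => [|k s IH].
  by rewrite big_nil.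
by rewrite big_cons -[coeff k x]mulr1 -freegUZ; apply: TD.
Qed.
End FreeModule.

(* Group algebra k[G] of an additively written abelian group G. *)
Section GroupAlgebra.
Variables (k : comNzRingType) (G : zmodType).

Definition gralg := {freeg G / k}.
HB.instance Definition _ := GRing.Lmodule.on gralg.

Definition gralg_one : gralg := << 0 >>.
(* the bilinear extension of (g, h) |-> g + h *)
Definition gralg_mul (x y : gralg) : gralg :=
  fglift (fun g => fglift (fun h => << g + h >> : gralg) y) x.

Lemma gralg_mulPl a x y z :
  gralg_mul (a *: x + y) z = a *: gralg_mul x z + gralg_mul y z.
Proof. exact: linearP. Qed.

Lemma gralg_mul0l z : gralg_mul 0 z = 0.
Proof. exact: linear0. Qed.

Lemma gralg_mulPr a x y z :
  gralg_mul x (a *: y + z) = a *: gralg_mul x y + gralg_mul x z.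
Proof.
elim/free_ind: x => [|b g x IH].
  by rewrite !gralg_mul0l scaler0 addr0.
rewrite !gralg_mulPl IH /gralg_mul !fgliftU linearP /=.
by rewrite !scalerDr !scalerA [a * b]mulrC addrACA.
Qed.

Lemma gralg_mul0r x : gralg_mul x 0 = 0.
Proof.
by rewrite -[0 in LHS](addNr (0 : gralg)) -scaleN1r gralg_mulPr scaleN1r addNr.
Qed.

Lemma gralg_mulUU g h : gralg_mul << g >> << h >> = << g + h >>.
Proof. by rewrite /gralg_mul !fgliftU. Qed.

Lemma gralg_mulC : commutative gralg_mul.
Proof.
elim/free_ind=> [|a g x IHx] y; first by rewrite gralg_mul0l gralg_mul0r.
rewrite gralg_mulPl gralg_mulPr IHx; congr (_ *: _ + _).
elim/free_ind: y => [|b h y IHy]; first by rewrite gralg_mul0l gralg_mul0r.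
by rewrite gralg_mulPl gralg_mulPr IHy !gralg_mulUU [g + h]addrC.
Qed.

Lemma gralg_mulA : associative gralg_mul.
Proof.
elim/free_ind=> [|a g x IHx] y z; first by rewrite !gralg_mul0l.
rewrite !gralg_mulPl IHx; congr (_ *: _ + _).
elim/free_ind: y => [|b h y IHy].
  by rewrite gralg_mul0l gralg_mul0r gralg_mul0l.
rewrite !(gralg_mulPl, gralg_mulPr) IHy; congr (_ *: _ + _).
elim/free_ind: z {IHy} => [|c l z IHz]; first by rewrite !gralg_mul0r.
by rewrite !gralg_mulPr IHz !gralg_mulUU addrA.
Qed.

Lemma gralg_mul1 : left_id gralg_one gralg_mul.
Proof.
elim/free_ind=> [|a g x IHx]; first by rewrite gralg_mul0r.
by rewrite gralg_mulPr IHx gralg_mulUU add0r.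
Qed.

Lemma gralg_mulDl : left_distributive gralg_mul +%R.
Proof. by move=> x y z; rewrite -[x]scale1r gralg_mulPl !scale1r. Qed.

Lemma gralg_one_neq0 : gralg_one != 0.
Proof. by rewrite freegU_eq0 oner_eq0. Qed.

HB.instance Definition _ := GRing.Zmodule_isComNzRing.Build gralg
  gralg_mulA gralg_mulC gralg_mul1 gralg_mulDl gralg_one_neq0.
End GroupAlgebra.

(* Z_N[Z^D], faithful for N >= 2 only: 'Z_0 and 'Z_1 both denote Z/2. *)
Definition laurent (N D : nat) : comNzRingType :=
  gralg 'Z_N {ffun 'I_D -> int}.

Definition lvar (N D : nat) (i : 'I_D) : laurent N D :=
  << [ffun k : 'I_D => (k == i)%:Z] >>.

Section Regular.
Variables (R : comPzRingType) (s : nat) (f : s.-tuple R).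

(* For i = 0 the quotient is R / (0) = R, the ideal (take 0 f) being zero. *)
Definition regular_seq : Prop :=
  forall (i : 'I_s) (x : qring (take i f)), tnth f i *: x = 0 -> x = 0.
End Regular.

(* Tensor product over R: the free module on A x B modulo bilinearity. *)
Section Tensor.
Variables (R : comNzRingType) (A B : lmodType R).

Inductive tens_rel : {freeg (A * B)%type / R} -> Prop :=
| tens_Dl a a' b : tens_rel (<< (a + a', b) >> - << (a, b) >> - << (a', b) >>)
| tens_Dr a b b' : tens_rel (<< (a, b + b') >> - << (a, b) >> - << (a, b') >>)
| tens_Zl r a b : tens_rel (<< (r *: a, b) >> - r *: << (a, b) >>)
| tens_Zr r a b : tens_rel (<< (a, r *: b) >> - r *: << (a, b) >>).

Definition tens : lmodType R := quo tens_rel.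

Definition tensor (a : A) (b : B) : tens := qproj tens_rel << (a, b) >>.

Lemma tensorDl a a' b : tensor (a + a') b = tensor a b + tensor a' b.
Proof.
apply/eqP; rewrite -subr_eq0 opprD addrA -!linearB; apply/eqP.
exact/qproj_gen/tens_Dl.
Qed.

Lemma tensorDr a b b' : tensor a (b + b') = tensor a b + tensor a b'.
Proof.
apply/eqP; rewrite -subr_eq0 opprD addrA -!linearB; apply/eqP.
exact/qproj_gen/tens_Dr.
Qed.

Lemma tensorZl r a b : tensor (r *: a) b = r *: tensor a b.
Proof.
apply/eqP; rewrite -subr_eq0 -linearZ -linearB; apply/eqP.
exact/qproj_gen/tens_Zl.
Qed.

Lemma tensorZr r a b : tensor a (r *: b) = r *: tensor a b.
Proof.
apply/eqP; rewrite -subr_eq0 -linearZ -linearB; apply/eqP.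
exact/qproj_gen/tens_Zr.
Qed.

Lemma tensor0l b : tensor 0 b = 0.
Proof. by rewrite -(scale0r 0) tensorZl scale0r. Qed.

Lemma tens_ind (T : tens -> Prop) :
  T 0 -> (forall r a b u, T u -> T (r *: tensor a b + u)) -> forall u, T u.
Proof.
move=> T0 TD; apply: qprojW; elim/free_ind=> [|r [a b] x IH].
  by rewrite linear0.
by rewrite linearP; apply: TD.
Qed.
End Tensor.

Section TensorMap.
Variables (R : comNzRingType) (A A' B : lmodType R) (f : {linear A -> A'}).

Definition tens_pre : {linear {freeg (A * B)%type / R} -> tens A' B} :=
  fglift (fun p => tensor (f p.1) p.2).

Lemma tens_preP x : tens_rel x -> tens_pre x = 0.
Proof.
case=> [a a' b|a b b'|r a b|r a b];
  rewrite ?(linearB, linearZ) /= !fgliftU /=.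
- by rewrite linearD tensorDl -addrA -opprD subrr.
- by rewrite tensorDr -addrA -opprD subrr.
- by rewrite linearZ tensorZl scalerN subrr.
- by rewrite tensorZr scalerN subrr.
Qed.

Definition tens_map : {linear tens A B -> tens A' B} := qlift tens_preP.

Lemma tens_mapE a b : tens_map (tensor a b) = tensor (f a) b.
Proof. by rewrite [LHS]qliftE /= fgliftU. Qed.
End TensorMap.

(* Chain complexes ... -> C 2 -> C 1 -> C 0 -> 0. *)
Record complex (R : pzRingType) := Complex {
  cobj :> nat -> lmodType R;
  cdiff : forall n, {linear cobj n.+1 -> cobj n};
  cdiffK : forall n x, cdiff n (cdiff n.+1 x) = 0
}.

Section Kernel.
Variables (R : pzRingType) (A B : lmodType R) (f : {linear A -> B}).

Definition ker_pred : {pred A} := fun x => f x == 0.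

Lemma ker_submod : submod_closed ker_pred.
Proof.
split=> [|a x y]; first by rewrite unfold_in linear0.
by rewrite !unfold_in => /eqP fx /eqP fy; rewrite linearP fx fy scaler0 addr0.
Qed.

HB.instance Definition _ := GRing.isSubmodClosed.Build R A ker_pred ker_submod.

Record ker := Ker { ker_val :> A; _ : ker_val \in ker_pred }.
HB.instance Definition _ := [isSub for ker_val].
HB.instance Definition _ := [Choice of ker by <:].
HB.instance Definition _ := [SubChoice_isSubLmodule of ker by <:].
End Kernel.

Section Homology.
Variables (R : pzRingType) (C : complex R).

(* the differential out of degree n *)
Definition cout (n : nat) : {linear C n -> C n.-1} :=
  match n with 0%N => \0%R | m.+1 => cdiff C m end.

Definition homology (n : nat) : lmodType R :=
  quo (fun z : ker (cout n) => exists y, val z = cdiff C n y).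
End Homology.

Section TensorComplex.
Variables (R : comNzRingType) (C : complex R) (B : lmodType R).

Lemma tens_diffK n (u : tens (C n.+2) B) :
  tens_map B (cdiff C n) (tens_map B (cdiff C n.+1) u) = 0.
Proof.
elim/tens_ind: u => [|r a b u IH]; first by rewrite !linear0.
rewrite 2!linearP IH !tens_mapE cdiffK addr0.
by rewrite tensor0l scaler0.
Qed.

Definition tens_complex : complex R :=
  @Complex R (fun n => tens (C n) B) (fun n => tens_map B (cdiff C n)) tens_diffK.
End TensorComplex.

Section Koszul.
Variables (R : comNzRingType) (r : nat) (g : r.-tuple R).

Definition ksub (i : nat) := {A : {set 'I_r} | #|A| == i}.

(* The i-th exterior power of R^r; the coordinate at A = {a_1 < ... < a_i} is *)
(* the coefficient of e_(a_1) /\ ... /\ e_(a_i).                              *)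
Definition kobj (i : nat) : lmodType R := {ffun ksub i -> R^o}.

(* (-1)^(k-1) when a is the k-th smallest element of A. *)
Definition ksign (A : {set 'I_r}) (a : 'I_r) : R :=
  (-1) ^+ #|[set b in A | (b < a)%N]|.

Definition kdiff_fun (i : nat) (c : kobj i.+1) : kobj i :=
  [ffun B => \sum_(A : ksub i.+1) \sum_(a in val A | val A :\ a == val B)
     ksign (val A) a * tnth g a * c A].

Lemma kdiff_is_linear i : linear (@kdiff_fun i).
Proof.
move=> t c c'; apply/ffunP => B; rewrite !ffunE /= scaler_sumr -big_split.
apply: eq_bigr => A _; rewrite scaler_sumr -big_split.
apply: eq_bigr => a _ /=; rewrite !ffunE /GRing.scale /= mulrDr; congr (_ + _).
by rewrite mulrCA.
Qed.

HB.instance Definition _ i := GRing.isLinear.Build R (kobj i.+1) (kobj i) *:%R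
  (@kdiff_fun i) (@kdiff_is_linear i).

Definition kdiff (i : nat) : {linear kobj i.+1 -> kobj i} := @kdiff_fun i.

Lemma ksign_swap (A : {set 'I_r}) (a b : 'I_r) : a \in A -> (b < a)%N -> b \in A ->
  ksign A a * ksign (A :\ a) b = - (ksign A b * ksign (A :\ b) a).
Proof.
move=> Aa ltba Ab; rewrite /ksign.
have -> : [set x in A :\ a | (x < b)%N] = [set x in A | (x < b)%N].
  apply/setP => x; rewrite !inE; case: eqP => //= ->.
  by rewrite ltnNge (ltnW ltba) andbF.
have -> : [set x in A | (x < a)%N] = b |: [set x in A :\ b | (x < a)%N].
  apply/setP => x; rewrite !inE; case: eqP => //= ->.
  by rewrite Ab ltba.
by rewrite cardsU1 !inE eqxx /= exprS mulN1r mulNr mulrC.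
Qed.

Lemma kdiffK i (c : kobj i.+2) : kdiff i (kdiff i.+1 c) = 0.
Proof.
apply/ffunP => C; rewrite !ffunE.
pose G (A : ksub i.+2) a b := ksign (val A) a * ksign (val A :\ a) b *
  (tnth g a * tnth g b * c A).
transitivity (\sum_(A : ksub i.+2) \sum_(a in val A)
   \sum_(b in val A | (b != a) && (val A :\ a :\ b == val C)) G A a b).
  under eq_bigr => B _.
    under eq_bigr => b _.
      rewrite ffunE mulr_sumr.
      under eq_bigr => A _ do rewrite mulr_sumr.
      over.
    rewrite exchange_big /=.
    over.
  rewrite exchange_big /=; apply: eq_bigr => A _.
  under eq_bigr => B _.
    rewrite (exchange_big_dep (fun a => a \in val A)) /=; last by move=> ? ? _ /andP[].
    over.
  rewrite exchange_big /=; apply: eq_bigr => a Aa.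
  have cA : #|val A :\ a| == i.+1.
    by move: (eqP (valP A)); rewrite (cardsD1 a) Aa => -[/eqP].
  rewrite (bigD1 (Sub (val A :\ a) cA)) //= [X in _ + X]big1 ?addr0; last first.
    move=> B neB; rewrite big_pred0 // => b.
    have -> : (val A :\ a == val B) = false; last by rewrite !andbF.
    by apply: contraNF neB => /eqP eB; apply/eqP/val_inj; rewrite /= -eB.
  apply: eq_big => [b|b _].
    by rewrite Aa eqxx !andbT !inE; case: (b == a); rewrite ?andbF.
  by rewrite /G; ring.
apply: big1 => A _; set F := fun a b : 'I_r => if (a \in val A) && (b \in val A) &&
  ((b != a) && (val A :\ a :\ b == val C)) then G A a b else 0.
have FN a b : F a b = - F b a.
  rewrite /F [(b \in _) && _]andbC [a == b]eq_sym.
  have -> : val A :\ b :\ a = val A :\ a :\ b by rewrite !setDDl setUC.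
  case: ifP => [|_]; last by rewrite oppr0.
  move=> /andP[/andP[Aa Ab] /andP[neq _]]; rewrite /G [_ b * _ a]mulrC -mulNr.
  congr (_ * _); case: (ltngtP b a) => [ba|ab|/val_inj eba].
  - exact: ksign_swap.
  - by rewrite [in RHS](ksign_swap Ab ab Aa) opprK.
  - by rewrite eba eqxx in neq.
have F0 a : F a a = 0 by rewrite /F eqxx andbF.
have sF : \sum_(a in val A) \sum_(b in val A | (b != a) &&
    (val A :\ a :\ b == val C)) G A a b = \sum_a \sum_b F a b.
  rewrite big_mkcond; apply: eq_bigr => a _; case: ifP => Aa.
    by rewrite big_mkcond; apply: eq_bigr => b _; rewrite /F Aa.
  by rewrite big1 // => b _; rewrite /F Aa.
rewrite sF.
have lt_gt : \sum_a \sum_b F a b =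
    \sum_(a < r) \sum_(b < r | (b < a)%N) F a b +
    \sum_(a < r) \sum_(b < r | (a < b)%N) F a b.
  rewrite -big_split; apply: eq_bigr => a _ /=.
  rewrite (bigID (fun b : 'I_r => (b < a)%N)) /=; congr (_ + _).
  under eq_bigl => b do rewrite -leqNgt.
  rewrite (bigD1 a) //= F0 add0r; apply: eq_bigl => b.
  by rewrite ltn_neqAle andbC eq_sym.
rewrite lt_gt [X in _ + X](exchange_big_dep predT) //= -big_split big1 // => a _.
by rewrite -big_split big1 //= => b _; rewrite (FN a b) addNr.
Qed.

Definition koszul : complex R := Complex kdiffK.
End Koszul.

(* The free resolution ... -> F 1 -> F 0 -> A with F 0 free on the set A and  *)
(* F (n+1) free on the set of n-cycles. A stage is the map out of F n.        *)
Section FreeResolution.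
Variables (R : comNzRingType) (A : lmodType R).

Record stage := Stage {
  src : lmodType R;
  tgt : lmodType R;
  smap : {linear src -> tgt}
}.

Definition free (X : lmodType R) : lmodType R := {freeg X / R}.

Definition augmentation : stage := @Stage (free A) A (fglift id).

Definition next_stage (d : stage) : stage :=
  @Stage (free (ker (smap d))) (src d) (fglift (@ker_val _ _ _ (smap d))).

Definition res_stage (n : nat) : stage := iter n next_stage augmentation.

Definition res_obj (n : nat) : lmodType R := src (res_stage n).

Definition res_diff (n : nat) : {linear res_obj n.+1 -> res_obj n} :=
  smap (res_stage n.+1).

Lemma next_stageK d x : smap d (smap (next_stage d) x) = 0.
Proof.
elim/free_ind: x => [|a k x IH]; first by rewrite !linear0.
have Ek : smap (next_stage d) << k >> = val k by apply: fgliftU.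
have dk : smap d (val k) = 0 by apply/eqP; case: (k).
by rewrite 2!linearP IH addr0 Ek dk scaler0.
Qed.

Lemma res_diffK n x : res_diff n (res_diff n.+1 x) = 0.
Proof. exact: (@next_stageK (res_stage n.+1)). Qed.

Definition free_res : complex R := Complex res_diffK.

Lemma augmentation_surj (a : A) : exists x, smap augmentation x = a.
Proof. by exists << a >>; apply: fgliftU. Qed.

Lemma next_stage_exact d y : smap d y = 0 -> exists x, smap (next_stage d) x = y.
Proof.
move=> /eqP dy; exists << Ker (f := smap d) dy >>; exact: fgliftU.
Qed.
End FreeResolution.

(* The left derived functors of - (x) B at A, on the resolution free_res A.   *)
Definition Tor (R : comNzRingType) (j : nat) (A B : lmodType R) : lmodType R :=
  homology (tens_complex (free_res A) B) j.

Definition koszul_with (R : comNzRingType) (r : nat) (g : r.-tuple R)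
  (M : lmodType R) : complex R := tens_complex (koszul g) M.

Definition period (N D : nat) (L : 'I_D -> nat) : D.-tuple (laurent N D) :=
  [tuple lvar N i ^+ L i - 1 | i < D].

Definition logicalZ (N D s : nat) (f : s.-tuple (laurent N D))
    (L : 'I_D -> nat) (j : nat) : lmodType (laurent N D) :=
  homology (koszul_with f (qring (period N L))) j.

(* Main.v *)
From HB Require Import structures.
From mathcomp Require Import all_boot all_order all_algebra.
From mathcomp.classical Require Import boolp.
From mathcomp.multinomials Require Import freeg.
Require Import Defs.

Set Implicit Arguments.
Unset Strict Implicit.
Unset Printing Implicit Defensive.

Import GRing.Theory.

(* Tor is balanced by dimension shifting: if C -> A and D -> B are flat         *)
(* resolutions with syzygies A_k and B_l, then                                  *)
(*   ker (A_k+1 (x) B_l -> C_k (x) B_l) ~ ker (A_k (x) B_l+1 -> A_k (x) D_l)    *)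
(*                                      = ker (A_k (x) B_l+1 -> C_k-1 (x) B_l+1) *)
(* and iterating walks from H_n (C (x) B) to H_n (D (x) A). Any two flat        *)
(* resolutions will do: taking K(f) for D and either the free resolution of     *)
(* R/(b) or K(b) for C gives both isomorphisms, since the Koszul complexes of   *)
(* the regular sequences f and b are resolutions.                               *)

Local Open Scope ring_scope.

(** * Linear relations and homology *)

(** Each of the three modules is the homology of a flat resolution of [R/(b)] or [R/(f)] tensored
    with the other quotient, so the claim is that Tor can be computed from a flat resolution of
    either argument. [isom_homology_balance] proves this without double complexes: positive-degree
    homology is the kernel of [A_(k+1) (x) B -> C_k (x) B], and the chase [isom_ker_tens] lets a
    syzygy of [A] be traded for one of [B]. Two inputs concern the sequences. By
    [koszul_resolution], the Koszul complex of a regular sequence is exact; the induction on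
    generators is [ext_exact], where an ideal condition on the coefficient at the empty set treats
    degree 0 together with the other degrees. By [regular_period], [b] is regular: reducing the
    earlier exponents modulo [L] gives normal forms, and multiplication by the next [x_i^(L_i)]
    moves monomials along infinite orbits, so it fixes no nonzero element of finite support.
    Finally, an [R]-linear isomorphism between modules killed by [b] is [R_L]-linear
    ([isom_annmod]). *)

Section Isom.
Variable R : pzRingType.
Implicit Types X Y Z : lmodType R.

Lemma isom_sym X Y : isom X Y -> isom Y X.
Proof.
case=> f [g gK fK].
have gL : linear g by move=> a x y; apply: (can_inj gK); rewrite linearP !fK.
pose g' : {linear Y -> X} := HB.pack g (GRing.isLinear.Build R Y X *:%R g gL).
by exists g'; exists f.
Qed.

Lemma isom_trans Y X Z : isom X Y -> isom Y Z -> isom X Z.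
Proof.
case=> f bf [g bg]; exists (g \o f); exact: bij_comp.
Qed.

(** Such a relation is the graph of an isomorphism: applied to differences, the conditions at 0 give
    uniqueness on both sides. Diagram chases can thus be stated as relations, with no choice of
    lifts to prove independent. *)
Lemma isom_rel X Y (T : X -> Y -> Prop) :
  (forall a x x' y y', T x y -> T x' y' -> T (a *: x + x') (a *: y + y')) ->
  (forall x, exists y, T x y) -> (forall y, exists x, T x y) ->
  (forall y, T 0 y -> y = 0) -> (forall x, T x 0 -> x = 0) -> isom X Y.
Proof.
move=> TL Tl Tr T0l T0r.
have Tfun x y y' : T x y -> T x y' -> y = y'.
  move=> Txy Txy'; have /T0l /eqP : T 0 (-1 *: y' + y).
    by have := TL (-1) x x y' y Txy' Txy; rewrite !scaleN1r addNr.
  by rewrite scaleN1r addrC subr_eq0 => /eqP.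
have Tinj x x' y : T x y -> T x' y -> x = x'.
  move=> Txy Tx'y; have /T0r /eqP : T (-1 *: x' + x) 0.
    by have := TL (-1) x' x y y Tx'y Txy; rewrite !scaleN1r addNr.
  by rewrite scaleN1r addrC subr_eq0 => /eqP.
have [f fT] := choice Tl; have [g gT] := choice Tr.
have fL : linear f by move=> a x y; apply: Tfun (fT _) (TL _ _ _ _ _ (fT _) (fT _)).
pose f' : {linear X -> Y} := HB.pack f (GRing.isLinear.Build R X Y *:%R f fL).
exists f'; exists g => z; first exact: Tinj (gT _) (fT z).
exact: Tfun (fT _) (gT z).
Qed.

Lemma kerP X Y (f : {linear X -> Y}) (z : ker f) : f (val z) = 0.
Proof. by apply/eqP; case: z. Qed.

Lemma ker_lift X Y (f : {linear X -> Y}) x : f x = 0 -> exists z : ker f, val z = x.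
Proof. by move/eqP => fx; exists (Ker (f := f) fx). Qed.

Lemma isom_ker X X' Y Y' (f : {linear X -> X'}) (m : {linear X -> Y})
    (m' : {linear X' -> Y'}) : bijective f ->
  (forall x, m x = 0 <-> m' (f x) = 0) -> isom (ker m) (ker m').
Proof.
move=> [g gK fK] mm'; apply: (isom_rel (T := fun x y => val y = f (val x))).
- by move=> a x x' y y' /= e e'; rewrite [RHS]linearP -e -e'.
- by move=> x; apply: ker_lift; apply/mm'/kerP.
- move=> y; have [|x xE] := @ker_lift _ _ m (g (val y)).
    by apply/mm'; rewrite fK kerP.
  by exists x; rewrite xE fK.
- by move=> y yE; apply: val_inj; rewrite yE /= linear0.
- move=> x /esym xE; apply: val_inj; apply: (can_inj gK).
  by rewrite xE /= linear0.
Qed.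

Lemma span_im X Y (f : {linear X -> Y}) y :
  span (fun y => exists x, y = f x) y -> exists x, y = f x.
Proof.
elim=> [|a _ _ [x ->] _ [x' ->]]; first by exists 0; rewrite linear0.
by exists (a *: x + x'); rewrite linearP.
Qed.

(** Here [q] presents the cokernel of the incoming differential and [m] is the induced outgoing map.
    Cokernels, unlike cycles, survive tensoring, which makes this description of homology usable for
    [tens_complex]. *)
Lemma isom_homology (C : complex R) n (V : lmodType R) (q : {linear C n -> V})
    (m : {linear V -> C n.-1}) :
  (forall v, exists x, q x = v) -> (forall x, cout C n x = m (q x)) ->
  (forall x, q x = 0 <-> exists y, x = cdiff C n y) -> isom (homology C n) (ker m).
Proof.
move=> qS mq qK.
pose P := fun z : ker (cout C n) => exists y, val z = cdiff C n y.
have PE z : span P z <-> exists y, val z = cdiff C n y.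
  split=> [|Pz]; last by apply: span_gen.
  elim=> [|a x z' [y yE] _ [y' yE']]; first by exists 0; rewrite linear0.
  by exists (a *: y + y'); rewrite linearP /= yE yE'.
apply: (isom_rel (T := fun (h : homology C n) (v : ker m) =>
  exists2 z, h = qproj P z & val v = q (val z))).
- move=> a x x' y y' [z -> zE] [z' -> zE']; exists (a *: z + z').
    by rewrite linearP.
  by rewrite /= linearP -zE -zE'.
- elim/qprojW=> z; have [|v vE] := @ker_lift _ _ m (q (val z)).
    by rewrite -mq kerP.
  by exists v, z.
- move=> v; have [x xE] := qS (val v).
  have [|z zE] := @ker_lift _ _ (cout C n) x; first by rewrite mq xE kerP.
  by exists (qproj P z), z; rewrite // zE xE.
- move=> v [z /esym z0 vE]; apply: val_inj; rewrite vE; apply/qK/PE.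
  by move: z0; rewrite -[X in _ = X](linear0 (qproj P)) => /qprojP; rewrite subr0.
- move=> h [z -> /esym/qK zE].
  by rewrite -(linear0 (qproj P)); apply/qprojP; rewrite subr0; apply/PE.
Qed.
End Isom.

(** * Tensor products: universal property, right exactness, flatness *)

Section TensorTheory.
Variable R : comNzRingType.
Implicit Types A B M P : lmodType R.

Lemma tensor0r A B (a : A) : tensor a (0 : B) = 0.
Proof. by rewrite -(scale0r 0) tensorZr scale0r. Qed.

Section Lift.
Variables (A B M : lmodType R) (h : A -> B -> M).
Hypothesis hl : forall b, linear (h^~ b).
Hypothesis hr : forall a, linear (h a).

Let lift_pre : {linear {freeg (A * B)%type / R} -> M} :=
  fglift (fun p => h p.1 p.2).

Lemma tens_lift_subproof x : tens_rel x -> lift_pre x = 0.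
Proof.
case=> [a a' b|a b b'|r a b|r a b];
  rewrite ?(linearB, linearZ) /= !fgliftU /=.
- by rewrite -[a]scale1r hl !scale1r -addrA -opprD subrr.
- by rewrite -[b]scale1r hr !scale1r -addrA -opprD subrr.
(* Linearity at [-1, 0, 0] yields [h 0 b = 0]. *)
- have := hl b (-1) 0 0; rewrite scaler0 addr0 scaleN1r addNr => h0.
  by rewrite -[r *: a]addr0 hl h0 addr0 scalerN subrr.
- have := hr a (-1) 0 0; rewrite scaler0 addr0 scaleN1r addNr => h0.
  by rewrite -[r *: b]addr0 hr h0 addr0 scalerN subrr.
Qed.

Definition tens_lift : {linear tens A B -> M} := qlift tens_lift_subproof.

Lemma tens_liftE a b : tens_lift (tensor a b) = h a b.
Proof. by rewrite [LHS]qliftE /= fgliftU. Qed.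
End Lift.

Lemma tens_linear_eq A B M (f g : {linear tens A B -> M}) :
  (forall a b, f (tensor a b) = g (tensor a b)) -> f =1 g.
Proof.
move=> fg; elim/tens_ind => [|r a b u IH]; first by rewrite !linear0.
by rewrite !linearP fg IH.
Qed.

Lemma tens_swap_l A B (b : B) : linear (fun a : A => tensor b a).
Proof. by move=> r x y; rewrite tensorDr tensorZr. Qed.
Lemma tens_swap_r A B (a : A) : linear (fun b : B => tensor b a).
Proof. by move=> r x y; rewrite tensorDl tensorZl. Qed.

Definition tens_swap A B : {linear tens A B -> tens B A} :=
  tens_lift (@tens_swap_l A B) (@tens_swap_r A B).

Lemma tens_swapE A B (a : A) (b : B) : tens_swap A B (tensor a b) = tensor b a.
Proof. exact: tens_liftE. Qed.

Lemma tens_swapK A B : cancel (tens_swap A B) (tens_swap B A).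
Proof.
move=> u; apply: (@tens_linear_eq _ _ _ (tens_swap B A \o tens_swap A B) idfun).
by move=> a b; rewrite -[LHS]/(tens_swap B A (tens_swap A B _)) !tens_swapE.
Qed.

Lemma tens_swap_bij A B : bijective (tens_swap A B).
Proof. by exists (tens_swap B A); apply: tens_swapK. Qed.

(** Conjugation by the swap lets surjectivity and exactness in the second factor be inherited from
    the first. *)
Definition tens_mapr A B B' (g : {linear B -> B'}) : {linear tens A B -> tens A B'} :=
  tens_swap B' A \o tens_map A g \o tens_swap A B.

Lemma tens_maprE A B B' (g : {linear B -> B'}) (a : A) b :
  tens_mapr A g (tensor a b) = tensor a (g b).
Proof.
rewrite -[LHS]/(tens_swap B' A (tens_map A g (tens_swap A B (tensor a b)))).
by rewrite tens_swapE tens_mapE tens_swapE.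
Qed.

Lemma tens_mapr_swap A B B' (g : {linear B -> B'}) u :
  tens_mapr A g (tens_swap B A u) = tens_swap B' A (tens_map A g u).
Proof. by congr (tens_swap _ _ (tens_map _ _ _)); apply: tens_swapK. Qed.

Lemma tens_map_swap A B B' (g : {linear B -> B'}) u :
  tens_map A g (tens_swap A B u) = tens_swap A B' (tens_mapr A g u).
Proof. exact/esym/tens_swapK. Qed.

Lemma tens_mapC A A' B B' (f : {linear A -> A'}) (g : {linear B -> B'}) u :
  tens_map B' f (tens_mapr A g u) = tens_mapr A' g (tens_map B f u).
Proof.
apply: (@tens_linear_eq _ _ _ (tens_map B' f \o tens_mapr A g)
  (tens_mapr A' g \o tens_map B f)) => a b.
rewrite -[LHS]/(tens_map B' f (tens_mapr A g _)).
rewrite -[RHS]/(tens_mapr A' g (tens_map B f _)).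
by rewrite tens_mapE !tens_maprE tens_mapE.
Qed.

Lemma tens_map_comp A A' A'' B (f : {linear A -> A'}) (g : {linear A' -> A''})
    (h : {linear A -> A''}) : (forall x, h x = g (f x)) ->
  forall u, tens_map B h u = tens_map B g (tens_map B f u).
Proof.
move=> hE u; apply: (@tens_linear_eq _ _ _ _ (tens_map B g \o tens_map B f)).
by move=> a b; rewrite -[RHS]/(tens_map B g (tens_map B f _)) !tens_mapE hE.
Qed.

Lemma tens_map_surj A A' B (f : {linear A -> A'}) :
  (forall a, exists x, f x = a) -> forall u, exists x, tens_map B f x = u.
Proof.
move=> fS; elim/tens_ind=> [|r a b u [x xE]]; first by exists 0; rewrite linear0.
have [a' aE] := fS a; exists (r *: tensor a' b + x).
by rewrite linearP tens_mapE aE xE.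
Qed.

(* Right exactness: choosing preimages under p gives a well-defined inverse of  *)
(* the map coker (i (x) 1) -> A (x) B induced by p.                             *)
Lemma tens_map_exact A' P A B (i : {linear A' -> P}) (p : {linear P -> A}) :
  (forall a, exists x, p x = a) -> (forall x, p x = 0 <-> exists y, x = i y) ->
  forall u, tens_map B p u = 0 <-> exists v, u = tens_map B i v.
Proof.
move=> pS pi u; split; last first.
  case=> v ->; rewrite -(@tens_map_comp _ _ _ _ i p \0%R) => [|x].
    elim/tens_ind: v => [|r a b v IH]; first by rewrite linear0.
    by rewrite linearP IH tens_mapE /= tensor0l scaler0 addr0.
  by apply/esym/pi; exists x.
pose Q := fun y => exists v, y = tens_map B i v.
have [s sK] := choice pS.
have Qp x x' b : p x = p x' -> qproj Q (tensor x b) = qproj Q (tensor x' b).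
  move=> e; have [|y yE] := (pi (x - x')).1; first by rewrite linearB e subrr.
  apply/qprojP/span_gen; exists (tensor y b).
  by rewrite tens_mapE -yE tensorDl -[- x']scaleN1r tensorZl scaleN1r.
have hl b : linear (fun a => qproj Q (tensor (s a) b)).
  move=> r a a'; rewrite -linearP -tensorZl -tensorDl; apply: Qp.
  by rewrite linearP !sK.
have hr a : linear (fun b => qproj Q (tensor (s a) b)).
  by move=> r b b'; rewrite tensorDr tensorZr linearP.
pose t := tens_lift hl hr.
have tp : t \o tens_map B p =1 qproj Q.
  apply: tens_linear_eq => x b; rewrite -[LHS]/(t (tens_map B p _)).
  by rewrite tens_mapE tens_liftE; apply/Qp/sK.
move=> u0; have := tp u; rewrite -[LHS]/(t (tens_map B p u)) u0 linear0 -(linear0 (qproj Q)).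
by move=> /esym/qprojP; rewrite subr0 => /span_im.
Qed.

Lemma tens_mapr_surj A B B' (f : {linear B -> B'}) :
  (forall a, exists x, f x = a) -> forall u, exists x, tens_mapr A f x = u.
Proof.
move=> fS u; have [x xE] := tens_map_surj (B := A) fS (tens_swap A B' u).
by exists (tens_swap B A x); rewrite tens_mapr_swap xE tens_swapK.
Qed.

Lemma tens_mapr_exact A' P A B (i : {linear A' -> P}) (p : {linear P -> A}) :
  (forall a, exists x, p x = a) -> (forall x, p x = 0 <-> exists y, x = i y) ->
  forall u, tens_mapr B p u = 0 <-> exists v, u = tens_mapr B i v.
Proof.
move=> pS pi u; have E := tens_map_exact (B := B) pS pi (tens_swap B P u).
split=> [u0|[v ->]].
  have [|v vE] := E.1; first by rewrite tens_map_swap u0 linear0.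
  by exists (tens_swap A' B v); rewrite tens_mapr_swap -vE tens_swapK.
apply: (can_inj (tens_swapK (A := B) (B := A))).
rewrite -tens_map_swap linear0; apply/(tens_map_exact pS pi).
by exists (tens_swap B A' v); rewrite tens_map_swap.
Qed.

Definition flat P := forall M M' (g : {linear M -> M'}),
  (forall x, g x = 0 -> x = 0) -> forall u, tens_mapr P g u = 0 -> u = 0.

Lemma flat_map P M M' (g : {linear M -> M'}) : flat P ->
  (forall x, g x = 0 -> x = 0) -> forall u, tens_map P g u = 0 -> u = 0.
Proof.
move=> fP gi u u0; apply: (can_inj (tens_swapK (A := M) (B := P))).
by rewrite linear0; apply: (fP _ _ _ gi); rewrite tens_mapr_swap u0 linear0.
Qed.

(** An element [u] of [P (x) M] is the sum of the [e k (x) co k u], where [co k] contracts with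
    [c k]. Contraction commutes with [g], so if [g] is injective and [u] dies in [P (x) M'], all
    [co k u] vanish. Allowing every finite [t] above [s] puts the expansions of several tensors on
    one common support. *)
Lemma flat_dual_basis P (K : choiceType) (e : K -> P) (c : K -> {linear P -> R^o}) :
  (forall x, exists s : seq K, forall t, uniq t -> {subset s <= t} ->
     x = \sum_(k <- t) (c k x : R) *: e k) -> flat P.
Proof.
move=> ec M M' g gi u u0.
have hl (V : lmodType R) k (b : V) : linear (fun x => (c k x : R) *: b).
  by move=> r x y; rewrite linearP scalerDl scalerA.
have hr (V : lmodType R) k x : linear (fun b : V => (c k x : R) *: b).
  by move=> r b b'; rewrite scalerDr !scalerA mulrC.
pose co V k := tens_lift (hl V k) (hr V k).
have co0 k : co M k u = 0.
  apply: gi; rewrite -[RHS](linear0 (co M' k)) -u0.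
  apply: (@tens_linear_eq _ _ _ (g \o co M k) (co M' k \o tens_mapr P g)) => x b.
  rewrite -[LHS]/(g (co M k _)) -[RHS]/(co M' k (tens_mapr P g _)).
  by rewrite tens_maprE !tens_liftE linearZ.
have [s sE] : exists s : seq K, forall t, uniq t -> {subset s <= t} ->
    u = \sum_(k <- t) tensor (e k) (co M k u).
  elim/tens_ind: {u0 co0} u => [|r x b u [s IH]].
    by exists [::] => t _ _; rewrite big1 // => k _; rewrite linear0 tensor0r.
  have [s' s'E] := ec x; exists (s ++ s') => t ut st.
  have /(IH _ ut) uE : {subset s <= t}.
    by move=> k ks; apply: st; rewrite mem_cat ks.
  have /(s'E _ ut) xE : {subset s' <= t}.
    by move=> k ks; apply: st; rewrite mem_cat ks orbT.
  under eq_bigr => k _ do rewrite linearP tensorDr tensorZr tens_liftE tensorZr.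
  rewrite big_split /= -uE -scaler_sumr; congr (_ *: _ + _).
  rewrite {1}xE; elim: {ut st uE xE} t => [|k t IHt]; first by rewrite !big_nil tensor0l.
  by rewrite !big_cons tensorDl tensorZl IHt.
rewrite (sE (undup s)) ?undup_uniq // => [|k]; last by rewrite mem_undup.
by rewrite big1 // => k _; rewrite co0 tensor0r.
Qed.

Lemma flat_freeg (K : choiceType) : flat {freeg K / R}.
Proof.
have cl k : linear (fun x : {freeg K / R} => coeff k x : R^o).
  by move=> a x y; rewrite coeffD coeffZ.
pose c k : {linear {freeg K / R} -> R^o} :=
  HB.pack (fun x : {freeg K / R} => coeff k x : R^o)
    (GRing.isLinear.Build R _ _ *:%R _ (cl k)).
apply: (@flat_dual_basis _ K (fun k => << k >>) c) => x; exists (dom x) => t ut st.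
rewrite -{1}[x]freeg_sumE /=.
under [RHS]eq_bigr => k _ do rewrite freegUZ mulr1.
rewrite [RHS](bigID (mem (dom x))) /= [X in _ + X]big1 ?addr0; last first.
  by move=> k /coeff_outdom ->; rewrite freegU0.
rewrite -[RHS]big_filter; apply: perm_big; apply: uniq_perm.
- exact: uniq_dom.
- exact: filter_uniq.
- move=> k; rewrite mem_filter; apply/idP/idP => [kx|/andP[] //].
  by rewrite kx st.
Qed.

Lemma flat_ffun (K : finType) : flat {ffun K -> R^o}.
Proof.
have cl k : linear (fun x : {ffun K -> R^o} => x k).
  by move=> a x y; rewrite !ffunE.
pose c k : {linear {ffun K -> R^o} -> R^o} :=
  HB.pack (fun x : {ffun K -> R^o} => x k)
    (GRing.isLinear.Build R _ _ *:%R _ (cl k)).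
apply: (@flat_dual_basis _ K (fun k => [ffun k' => (k' == k)%:R : R^o]) c) => x.
exists (enum K) => t ut st; apply/ffunP => k; rewrite sum_ffunE.
rewrite (bigD1_seq k) //=; last by apply: st; rewrite mem_enum.
rewrite big1 => [|k' /negPf kk']; first by rewrite !ffunE eqxx addr0 /GRing.scale /= mulr1.
by rewrite !ffunE eq_sym kk' scaler0.
Qed.
End TensorTheory.

(** * Syzygies and the balance of Tor *)

(** Degree 0 needs an equivalence, since [complex] says nothing about the augmentation. *)
Definition resolution (R : pzRingType) (C : complex R) (A : lmodType R)
    (eps : {linear C 0%N -> A}) : Prop :=
  [/\ forall a, exists x, eps x = a,
      forall x, eps x = 0 <-> exists y, x = cdiff C 0 y
    & forall n x, cdiff C n x = 0 -> exists y, x = cdiff C n.+1 y].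

Section Syzygies.
Variables (R : pzRingType) (C : complex R) (A : lmodType R).
Variable eps : {linear C 0%N -> A}.

(* The n-th syzygy of A in the resolution, as the cokernel of the differential *)
(* into degree n.                                                              *)
Definition syz (n : nat) : lmodType R :=
  if n is m.+1 then quo (fun x : C m.+1 => exists y, x = cdiff C m.+1 y) else A.

Definition syz_proj (n : nat) : {linear C n -> syz n} :=
  match n with 0%N => eps | m.+1 => qproj _ end.

Lemma syz_inj_subproof n x :
  (exists y, x = cdiff C n.+1 y) -> cdiff C n x = 0.
Proof. by case=> y ->; apply: cdiffK. Qed.

(** For a resolution, this and [syz_proj] form the short exact sequence [A_(n+1) -> C_n -> A_n],
    with [A_0 = A]. *)
Definition syz_inj (n : nat) : {linear syz n.+1 -> C n} :=
  qlift (@syz_inj_subproof n).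

Lemma syz_injE n x : syz_inj n (syz_proj n.+1 x) = cdiff C n x.
Proof. exact: qliftE. Qed.

Hypothesis res : resolution eps.

Lemma syz_projS n v : exists x, syz_proj n x = v.
Proof.
case: n v => [|n]; first by case: res.
by elim/qprojW=> x; exists x.
Qed.

Lemma syz_proj_cdiff n x : syz_proj n x = 0 <-> exists y, x = cdiff C n y.
Proof.
case: n x => [|n] x; first by case: res.
split=> [|[y ->]]; last by apply: qproj_gen; exists y.
rewrite -[X in _ = X](linear0 (syz_proj n.+1)) => /qprojP.
by rewrite subr0 => /span_im.
Qed.

Lemma syz_proj_inj n x : syz_proj n x = 0 <-> exists v, x = syz_inj n v.
Proof.
split=> [/syz_proj_cdiff[y ->]|[v ->]].
  by exists (syz_proj n.+1 y); rewrite syz_injE.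
have [y <-] := syz_projS v; rewrite syz_injE.
by apply/syz_proj_cdiff; exists y.
Qed.

Lemma syz_inj0 n v : syz_inj n v = 0 -> v = 0.
Proof.
have [x <-] := syz_projS v; rewrite syz_injE => dx.
by apply/syz_proj_cdiff; case: res => _ _; apply.
Qed.
End Syzygies.

Section Balance.
Variable R : comNzRingType.

(** By right exactness, [A_(n+1) (x) B] is still the cokernel of the incoming differential. *)
Lemma isom_homology_tens (C : complex R) (A : lmodType R)
    (eps : {linear C 0%N -> A}) (B : lmodType R) n : resolution eps ->
  isom (homology (tens_complex C B) n.+1) (ker (tens_map B (syz_inj C A n))).
Proof.
move=> res.
apply: (isom_homology (C := tens_complex C B) (n := n.+1)
  (q := tens_map B (syz_proj eps n.+1))) => [v|x|x].
- exact/tens_map_surj/syz_projS.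
- by apply: tens_map_comp => y; rewrite syz_injE.
- apply: tens_map_exact => [a|y]; first exact: syz_projS.
  exact: syz_proj_cdiff.
Qed.

(** This is [A (x) B], written as the kernel of a zero map; the target is [C 0] because [cout] uses
    [0.-1 = 0]. *)
Lemma isom_homology_tens0 (C : complex R) (A : lmodType R)
    (eps : {linear C 0%N -> A}) (B : lmodType R) : resolution eps ->
  isom (homology (tens_complex C B) 0)
    (ker (\0%R : {linear tens A B -> tens (C 0%N) B})).
Proof.
move=> res; have [eS eK _] := res.
apply: (isom_homology (C := tens_complex C B) (n := 0)
  (q := tens_map B eps)) => // [v|x]; first exact: tens_map_surj.
exact: tens_map_exact.
Qed.

(* Both kernels consist of the ways to fill a corner of the 3 x 3 diagram      *)
(* (A' -> P -> A) (x) (B' -> Q -> B); they are Tor_1 (A, B).                   *)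
Lemma isom_ker_tens (A' P A B' Q B : lmodType R)
    (i : {linear A' -> P}) (p : {linear P -> A})
    (k : {linear B' -> Q}) (q : {linear Q -> B}) : flat P -> flat Q ->
  (forall x, i x = 0 -> x = 0) -> (forall x, k x = 0 -> x = 0) ->
  (forall a, exists x, p x = a) -> (forall b, exists y, q y = b) ->
  (forall x, p x = 0 <-> exists a, x = i a) ->
  (forall y, q y = 0 <-> exists b, y = k b) ->
  isom (ker (tens_map B i)) (ker (tens_mapr A k)).
Proof.
move=> fP fQ i0 k0 pS qS pi qk.
(* The snake: [w] in [A' (x) Q] lifts [u], [t] in [P (x) B'] lifts [v], and both agree in
   [P (x) Q]. *)
apply: (isom_rel (T := fun u v => exists w t, [/\ val u = tens_mapr A' q w,
  val v = tens_map B' p t & tens_map Q i w = tens_mapr P k t])).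
- move=> a u u' v v' [w [t [uE vE wt]]] [w' [t' [uE' vE' wt']]].
  exists (a *: w + w'), (a *: t + t').
  by rewrite !linearP -uE -uE' -vE -vE' wt wt'.
- move=> u; have [w wE] := tens_mapr_surj qS (val u).
  have [|t tE] := (tens_mapr_exact (B := P) qS qk (tens_map Q i w)).1.
    by rewrite -tens_mapC wE kerP.
  have [|v vE] := @ker_lift _ _ _ (tens_mapr A k) (tens_map B' p t).
    rewrite -tens_mapC -tE; apply/(tens_map_exact pS pi); by exists w.
  by exists v, w, t.
- move=> v; have [t tE] := tens_map_surj pS (val v).
  have [|w wE] := (tens_map_exact (B := Q) pS pi (tens_mapr P k t)).1.
    by rewrite tens_mapC tE kerP.
  have [|u uE] := @ker_lift _ _ _ (tens_map B i) (tens_mapr A' q w).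
    rewrite tens_mapC -wE; apply/(tens_mapr_exact qS qk); by exists t.
  by exists u, w, t.
(* If [u = 0], then [w] comes from some [w'] in [A' (x) B']; flatness of [P] makes [t] the image of
   [w'], which [p] kills. The last case is symmetric, using flatness of [Q]. *)
- move=> v [w [t [/esym u0 vE wt]]]; apply: val_inj; rewrite vE.
  apply/(tens_map_exact pS pi).
  have [w' wE] := (tens_mapr_exact qS qk _).1 u0.
  exists w'; apply/eqP; rewrite -subr_eq0; apply/eqP/(fP _ _ _ k0).
  by rewrite linearB -wt wE tens_mapC subrr.
- move=> u [w [t [uE /esym v0 wt]]]; apply: val_inj; rewrite uE.
  apply/(tens_mapr_exact qS qk).
  have [t' tE] := (tens_map_exact pS pi _).1 v0.
  exists t'; apply/eqP; rewrite -subr_eq0; apply/eqP/(flat_map fQ i0).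
  by rewrite linearB wt tE tens_mapC subrr.
Qed.

Variables (C D : complex R) (A B : lmodType R).
Variables (eps : {linear C 0%N -> A}) (eta : {linear D 0%N -> B}).
Hypothesis resC : resolution eps.
Hypothesis resD : resolution eta.
Hypothesis flatC : forall n, flat (C n).
Hypothesis flatD : forall n, flat (D n).

Lemma isom_ker_syz k l :
  isom (ker (tens_map (syz D B l) (syz_inj C A k)))
       (ker (tens_mapr (syz C A k) (syz_inj D B l))).
Proof.
apply: (isom_ker_tens (p := syz_proj eps k) (q := syz_proj eta l)) => //.
- exact: syz_inj0 resC _.
- exact: syz_inj0 resD _.
- exact: syz_projS.
- exact: syz_projS.
- exact: syz_proj_inj.
- exact: syz_proj_inj.
Qed.

(* Composed with an injection, both maps become the natural map from           *)
(* A_k+1 (x) B_l+1 to C_k (x) D_l, so they have the same kernel.               *)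
Lemma isom_ker_syz_shift k l :
  isom (ker (tens_mapr (syz C A k.+1) (syz_inj D B l)))
       (ker (tens_map (syz D B l.+1) (syz_inj C A k))).
Proof.
apply: (isom_ker (f := idfun)) => [|u]; first by exists idfun.
split=> u0.
  apply: (flatC (syz_inj0 resD (n := l))).
  by rewrite -tens_mapC u0 linear0.
apply: (flat_map (@flatD l) (syz_inj0 resC (n := k))).
by rewrite tens_mapC u0 linear0.
Qed.

(** Alternating [isom_ker_syz] and [isom_ker_syz_shift] lowers [k] and raises [l] with [k + l]
    fixed, until the syzygy of [A] is [A] itself. *)
Lemma isom_ker_syz_balance k l :
  isom (ker (tens_map (syz D B l) (syz_inj C A k)))
       (ker (tens_mapr A (syz_inj D B (k + l)))).
Proof.
elim: k l => [|k IH] l; first exact: (isom_ker_syz 0 l).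
apply: isom_trans (isom_ker_syz _ _) _; apply: isom_trans (isom_ker_syz_shift _ _) _.
by rewrite addSnnS; apply: IH.
Qed.

Theorem isom_homology_balance n :
  isom (homology (tens_complex C B) n) (homology (tens_complex D A) n).
Proof.
case: n => [|n].
  apply: isom_trans (isom_homology_tens0 B resC) _.
  apply: isom_trans (isom_sym (isom_homology_tens0 A resD)).
  by apply: (isom_ker (f := tens_swap A B)); first exact: tens_swap_bij.
apply: isom_trans (isom_homology_tens B n resC) _.
apply: isom_trans (isom_sym (isom_homology_tens A n resD)).
have := isom_ker_syz_balance n 0; rewrite addn0 => /isom_trans; apply.
apply: (isom_ker (f := tens_swap _ _)) => [|u]; first exact: tens_swap_bij.
rewrite tens_map_swap; split=> [->|u0]; first by rewrite linear0.
by apply: (can_inj (tens_swapK (A := _) (B := _))); rewrite u0 linear0.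
Qed.
End Balance.

Section FreeRes.
Variables (R : comNzRingType) (A : lmodType R).

Lemma free_res_resolution :
  resolution (C := free_res A) (smap (augmentation A)).
Proof.
split=> [|x|n x]; first exact: augmentation_surj.
  split=> [/next_stage_exact[y <-]|[y ->]]; first by exists y.
  exact: next_stageK.
by move=> /(@next_stage_exact _ (res_stage A n.+1)) [y <-]; exists y.
Qed.

Lemma flat_free_res n : flat (free_res A n).
Proof. by case: n => [|n]; apply: flat_freeg. Qed.
End FreeRes.

(** * Passage to modules over the quotient ring *)

(** A class acts on both sides through the same representative in [R], so [R]-linearity suffices. *)
Lemma isom_annmod (R : comPzRingType) (s : seq R) (X Y : lmodType R)
    (sX : annihilated s X) (sY : annihilated s Y) :
  isom X Y -> isom (annmod sX) (annmod sY).
Proof.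
case=> f bf.
pose h : annmod sX -> annmod sY := f.
have hL : linear h.
  by move=> a x y; rewrite [LHS]linearD; rewrite /h linearZ.
pose h' : {linear annmod sX -> annmod sY} := HB.pack_for
  {linear annmod sX -> annmod sY} h
  (GRing.isLinear.Build _ (annmod sX) (annmod sY) *:%R h hL).
by exists h'.
Qed.

Lemma annihilated_isom (R : comPzRingType) (s : seq R) (X Y : lmodType R) :
  isom X Y -> annihilated s X -> annihilated s Y.
Proof.
by case=> f [g gK fK] sX a y sa; rewrite -(fK y) -linearZ sX // linear0.
Qed.

Lemma annihilated_qring (R : comPzRingType) (s : seq R) : annihilated s (qring s).
Proof.
move=> a x sa; elim/qringW: x => x; rewrite -linearZ /= -[RHS](linear0 (qproj _)).
apply/qprojP; rewrite subr0 /GRing.scale /= mulrC.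
exact/span_scale/(span_gen (P := fun x : R^o => x \in s)).
Qed.

Lemma annihilated_tens_homology (R : comNzRingType) (s : seq R) (C : complex R)
    (B : lmodType R) n :
  annihilated s B -> annihilated s (homology (tens_complex C B) n).
Proof.
move=> sB a; elim/qprojW=> z sa; rewrite -linearZ -[RHS](linear0 (qproj _)).
congr (qproj _ _); apply: val_inj; rewrite /=; elim/tens_ind: (ker_val z) => [|r x b u IH].
  by rewrite scaler0.
by rewrite scalerDr IH addr0 scalerA mulrC -scalerA -tensorZr sB // tensor0r scaler0.
Qed.

(** * The Koszul complex of a regular sequence *)

Lemma mem_take_tnth (T : eqType) n (t : n.-tuple T) (i : 'I_n) m :
  (i < m)%N -> tnth t i \in take m t.
Proof.
move=> im; have x0 := tnth t i; rewrite (tnth_nth x0) -(nth_take x0 im).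
by apply: mem_nth; rewrite size_take size_tuple; case: (ltnP m n) => // _; apply: ltn_ord.
Qed.

Section Ideal.
Variable R : comPzRingType.
Implicit Types (l : seq R) (x y r : R).

Definition ideal l r : Prop := span (fun x : R^o => x \in l) (r : R^o).

Lemma idealD l x y : ideal l x -> ideal l y -> ideal l (x + y).
Proof. exact: span_add. Qed.

Lemma idealN l x : ideal l x -> ideal l (- x).
Proof. exact: (@span_opp _ R^o). Qed.

Lemma idealMl l r x : ideal l x -> ideal l (r * x).
Proof. exact: (@span_scale _ R^o). Qed.

Lemma ideal_gen l x : x \in l -> ideal l x.
Proof. by move=> lx; apply: (@span_gen _ R^o). Qed.

Lemma ideal0 l : ideal l 0.
Proof. exact: span0. Qed.

Lemma sub_ideal l l' r : {subset l <= l'} -> ideal l r -> ideal l' r.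
Proof.
move=> ll'; elim=> [|a x y /ll' lx _ IH]; first exact: ideal0.
exact/idealD/IH/idealMl/ideal_gen.
Qed.

Lemma ideal_nil r : ideal [::] r -> r = 0.
Proof. by elim=> // a x y; rewrite in_nil. Qed.

Lemma ideal_rcons l x r : ideal (rcons l x) r -> exists t, ideal l (r - t * x).
Proof.
elim=> [|a y z + _ [t tI]]; first by exists 0; rewrite mul0r subr0; apply: ideal0.
rewrite mem_rcons inE => /orP[/eqP->|ly].
  by exists (t + a); rewrite mulrDl opprD [_ + z]addrC addrACA subrr addr0.
by exists t; rewrite -addrA; apply: idealD tI; apply/idealMl/ideal_gen.
Qed.

Lemma ideal_qring l r : qproj (fun x : R^o => x \in l) (r : R^o) = 0 <-> ideal l r.
Proof.
split=> [|lr]; last by rewrite -(linear0 (qproj _)); apply/qprojP; rewrite subr0.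
by rewrite -[X in _ = X](linear0 (qproj _)) => /qprojP; rewrite subr0.
Qed.

Lemma regular_seqP s (f : s.-tuple R) : regular_seq f <->
  forall (i : 'I_s) r, ideal (take i f) (tnth f i * r) -> ideal (take i f) r.
Proof.
split=> reg i => [r /ideal_qring fr|]; first by apply/ideal_qring/reg; rewrite -linearZ.
by elim/qringW=> r; rewrite -linearZ => /ideal_qring/reg/ideal_qring.
Qed.
End Ideal.

Section Exterior.
Variables (R : comNzRingType) (s : nat) (f : s.-tuple R).
Implicit Types (A B : {set 'I_s}) (a b k : 'I_s) (m : nat).
Implicit Types x y z c : {set 'I_s} -> R.

(* The Koszul differential on the whole exterior algebra, all degrees at once. *)
Definition ext_diff c B : R :=
  \sum_(a | a \notin B) ksign R (a |: B) a * tnth f a * c (a |: B).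

(* c lies in the exterior algebra on the first m generators. *)
Definition ext_low m c : Prop :=
  forall A a, a \in A -> (m <= a)%N -> c A = 0.

Lemma ext_diffD x y t B :
  ext_diff (fun A => x A + t * y A) B = ext_diff x B + t * ext_diff y B.
Proof.
rewrite /ext_diff mulr_sumr -big_split; apply: eq_bigr => a _ /=.
by rewrite mulrDr; congr (_ + _); rewrite mulrCA.
Qed.

Lemma eq_ext_diff x y B : x =1 y -> ext_diff x B = ext_diff y B.
Proof. by move=> xy; apply: eq_bigr => a _; rewrite xy. Qed.

Lemma ext_low_diff m x : ext_low m x -> ext_low m (ext_diff x).
Proof.
move=> lx B a Ba ma; apply: big1 => b _.
by rewrite (lx _ a) ?mulr0 // inE Ba orbT.
Qed.

Lemma ext_diff_ideal m x : ext_low m x -> ideal (take m f) (ext_diff x set0).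
Proof.
move=> lx; rewrite /ext_diff.
elim/big_ind: _ => [|u v|a _]; [exact: ideal0|exact: idealD|].
have [ma|am] := leqP m a; first by rewrite (lx _ a) ?inE ?eqxx // mulr0; apply: ideal0.
rewrite mulrAC; exact/idealMl/ideal_gen/mem_take_tnth.
Qed.

(** The grading involution, carrying the sign of the Leibniz rule. *)
Definition ext_sign x B : R := (-1) ^+ #|B| * x B.

Lemma ext_diff_sign x B : ext_diff (ext_sign x) B = - ext_sign (ext_diff x) B.
Proof.
rewrite /ext_diff /ext_sign mulr_sumr -sumrN; apply: eq_bigr => a aB.
by rewrite cardsU1 aB exprS mulN1r mulNr mulrN; congr (- _); rewrite mulrCA.
Qed.

(** The product [x /\ e_k]; no sign occurs when [x] involves only generators before [e_k]. *)
Definition ext_wedge k x B : R := if k \in B then x (B :\ k) else 0.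

(** Leibniz rule. Since [k] exceeds every index in [x], removing it leaves the other signs
    unchanged, and its own sign counts all of [B]. *)
Lemma ext_diff_wedge k x B : ext_low k x -> ext_diff (ext_wedge k x) B =
  if k \in B then ext_diff x (B :\ k) else tnth f k * ext_sign x B.
Proof.
move=> lx; rewrite /ext_diff /ext_wedge /ext_sign; case: ifP => kB.
  rewrite [RHS](bigD1 k) ?inE ?eqxx //= (lx _ k) ?setU11 // mulr0 add0r.
  apply: eq_big => [a|a aB].
    by rewrite !inE; case: eqP => [->|]; rewrite ?kB ?andbF //= andbT.
  have ak : a != k by apply: contraNneq aB => ->.
  have -> : k \in a |: B by rewrite !inE kB orbT.
  have -> : (a |: B) :\ k = a |: (B :\ k).
    by apply/setP => b; rewrite !inE; case: eqP => // ->; rewrite eq_sym (negPf ak).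
  have [ka|ak'] := leqP k a; first by rewrite (lx _ a) ?setU11 // !mulr0.
  congr (_ ^+ _ * _ * _); apply: eq_card => b; rewrite !inE.
  by case: (b =P k) => // ->; rewrite (ltnNge k) (ltnW ak') !andbF.
rewrite (bigD1 k) ?kB //= big1 ?addr0 => [|a /andP[_ ak]]; last first.
  by rewrite !inE kB eq_sym (negPf ak) mulr0.
rewrite setU11 setU1K ?kB //.
have [->|xB] := eqVneq (x B) 0; first by rewrite !mulr0.
rewrite mulrA [_ * tnth f k]mulrC; congr (_ * _ ^+ _ * _).
apply: eq_card => b; rewrite !inE; case: (b =P k) => [->|_] /=.
  by rewrite ltnn kB.
case bB: (b \in B) => //=; rewrite ltnNge; apply: contraNN xB => kb.
by apply/eqP/(lx _ b).
Qed.

(* Split c = c0 + c1 /\ e_m along the last generator: D c = 0 makes c1 a cycle  *)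
(* and D c0 = -+ f_m c1, so that f_m c1 (0) lies in (f_0 .. f_(m-1)), as does   *)
(* c1 (0) by regularity. Hence c1 = D y, and c - D (y /\ e_m) does not involve  *)
(* e_m. The free choice of y (0) puts its degree 0 part in (f_0 .. f_(m-1)).    *)
Lemma ext_exact m c : regular_seq f -> (m <= s)%N -> ext_low m c ->
  (forall B, ext_diff c B = 0) -> ideal (take m f) (c set0) ->
  exists2 y, ext_low m y & forall B, ext_diff y B = c B.
Proof.
move=> /regular_seqP reg; elim: m c => [|m IH] c ms lc dc.
  (* With no generators, [c] lives on the empty set, where the zero ideal kills it. *)
  rewrite take0 => /ideal_nil c0; exists (fun=> 0) => // B.
  rewrite /ext_diff big1 => [|a _]; last by rewrite mulr0.
  by have [->|[a aB]] := set_0Vmem B; rewrite ?c0 // (lc _ a).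
pose k := Ordinal ms; rewrite (take_nth 0) ?size_tuple //.
have -> : nth 0 f m = tnth f k by rewrite (tnth_nth 0).
move=> /ideal_rcons[t It].
pose c1 B := if k \in B then 0 else c (k |: B).
pose c0 B := if k \in B then 0 else c B.
have lt_k A a : k \notin A -> a \in A -> (m <= a)%N -> (m < a)%N.
  move=> kA aA; rewrite leq_eqVlt => /orP[/eqP ma|//].
  by case/negP: kA; rewrite (_ : k = a) //; apply: val_inj.
have lc1 : ext_low m c1.
  move=> A a aA ma; rewrite /c1; case: ifPn => // kA.
  by apply: (lc _ a); [rewrite inE aA orbT|exact: lt_k kA aA ma].
have lc0 : ext_low m c0.
  by move=> A a aA ma; rewrite /c0; case: ifPn => // kA; apply: (lc _ a aA); exact: lt_k kA aA ma.
have cE B : c B = c0 B + 1 * ext_wedge k c1 B.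
  rewrite mul1r /c0 /c1 /ext_wedge; case: ifP => kB; last by rewrite addr0.
  by rewrite add0r setD11 setD1K.
have dcE B : ext_diff c0 B + ext_diff (ext_wedge k c1) B = 0.
  by rewrite -[X in _ + X]mul1r -ext_diffD -(dc B); apply/esym/eq_ext_diff.
have dc1 B : ext_diff c1 B = 0.
  have [kB|kB] := boolP (k \in B); first exact: (ext_low_diff lc1 kB).
  have := dcE (k |: B); rewrite ext_diff_wedge // setU11 setU1K //.
  by rewrite (ext_low_diff lc0 (setU11 k B)) // add0r.
have dc0 B : ext_diff c0 B + tnth f k * ext_sign c1 B = 0.
  have := dcE B; rewrite ext_diff_wedge //; case: ifP => // kB _.
  by rewrite (ext_low_diff lc0 kB) // /ext_sign /c1 kB !mulr0 addr0.
have Ic1 : ideal (take m f) (c1 set0).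
  apply: (reg k); have := dc0 set0; rewrite /ext_sign cards0 mul1r addrC => /eqP.
  by rewrite addr_eq0 => /eqP ->; apply/idealN/ext_diff_ideal.
have [y' ly' dy'] := IH c1 (ltnW ms) lc1 dc1 Ic1.
(* [ext_diff] never reads the coefficient at the empty set, so it may be reset to [t], the
   multiplier of [f_m] in [c set0]. *)
pose y B := if B == set0 then t else y' B.
have ly : ext_low m y.
  move=> A a aA ma; rewrite /y ifN; first exact: ly' ma.
  by apply/set0Pn; exists a.
have dy B : ext_diff y B = c1 B.
  rewrite -dy'; apply: eq_bigr => a _; rewrite /y ifN //.
  by apply/set0Pn; exists a; rewrite setU11.
(* The part of [c - D (y /\ e_k)] free of [e_k]; its value at the empty set is [c set0 - t f_k]. *)
pose e B := c0 B + (- tnth f k) * ext_sign y B.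
have le : ext_low m e.
  by move=> A a aA ma; rewrite /e /ext_sign (lc0 _ a) // (ly _ a) // !mulr0 addr0.
have de B : ext_diff e B = 0.
  rewrite /e ext_diffD ext_diff_sign mulrNN.
  by rewrite -[RHS](dc0 B) /ext_sign dy.
have Ie : ideal (take m f) (e set0).
  by rewrite /e /c0 /ext_sign /y inE eqxx cards0 mul1r mulNr mulrC.
have [z lz dz] := IH e (ltnW ms) le de Ie.
exists (fun B => z B + 1 * ext_wedge k y B) => [A a aA ma|B].
  rewrite (lz _ a) //; last exact: ltnW.
  rewrite /ext_wedge; case: ifP => kA; rewrite ?mulr0 ?addr0 //.
  rewrite (ly _ a) ?mulr0 ?addr0 //; last exact: ltnW.
  rewrite !inE aA andbT; apply: contraTneq ma => ->; by rewrite ltnn.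
rewrite ext_diffD mul1r dz ext_diff_wedge //; case: ifP => kB.
  by rewrite (le _ k) // add0r dy /c1 setD11 setD1K.
by rewrite /e /c0 kB mulNr subrK.
Qed.

Definition ext_part i c : kobj R s i := [ffun A => c (val A)].

Definition ext_of i (c : kobj R s i) A : R := oapp c 0 (insub A).

Lemma ext_ofK i (c : kobj R s i) : ext_part i (ext_of c) = c.
Proof. by apply/ffunP => A; rewrite ffunE /ext_of valK. Qed.

Lemma ext_of_out i (c : kobj R s i) A : #|A| != i -> ext_of c A = 0.
Proof. by move=> Ai; rewrite /ext_of insubN. Qed.

(** For fixed [a], the only [A] containing [a] with [A :\ a = B] is [a |: B], and it occurs exactly
    when [a] is outside [B]. *)
Lemma kdiff_part i c : kdiff f i (ext_part i.+1 c) = ext_part i (ext_diff c).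
Proof.
apply/ffunP => B; rewrite !ffunE (exchange_big_dep predT) //= /ext_diff.
rewrite [RHS]big_mkcond; apply: eq_bigr => a _; case: ifPn => aB; last first.
  rewrite big_pred0 // => A; apply: contraNF aB => /andP[_ /eqP/setP/(_ a)].
  by rewrite setD11 /= => <-.
have cB : #|a |: val B| == i.+1 by rewrite cardsU1 aB (eqP (valP B)).
pose aB' : ksub s i.+1 := Sub (a |: val B) cB.
have aBE : val aB' = a |: val B by [].
rewrite (big_pred1 aB') ?ffunE ?aBE // => A; apply/andP/eqP => [[aA /eqP BE]|->].
  by apply: val_inj; apply: etrans (esym (setD1K aA)) (congr1 (setU [set a]) BE).
by rewrite aBE setU11 setU1K.
Qed.

Lemma ext_diff_of i (c : kobj R s i.+1) : kdiff f i c = 0 ->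
  forall B, ext_diff (ext_of c) B = 0.
Proof.
move=> dc B; have [Bi|Bi] := boolP (#|B| == i).
  have := congr1 (fun x : kobj R s i => x (Sub B Bi)) dc.
  by rewrite -{1}(ext_ofK c) kdiff_part !ffunE.
apply: big1 => a aB; rewrite ext_of_out ?mulr0 //.
by rewrite cardsU1 aB eqSS.
Qed.

Lemma ext_low_size x : ext_low s x.
Proof. by move=> A a _; rewrite leqNgt ltn_ord. Qed.

Definition ksub0 : ksub s 0 := Sub set0 (introT eqP (cards0 _)).

Definition koszul_aug_fun (c : kobj R s 0) : qring f := qproj _ (c ksub0).

Lemma koszul_aug_linear : linear koszul_aug_fun.
Proof. by move=> a x y; rewrite -linearP /koszul_aug_fun !ffunE. Qed.

HB.instance Definition _ := GRing.isLinear.Build R (kobj R s 0) (qring f) *:%R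
  koszul_aug_fun koszul_aug_linear.

Definition koszul_aug : {linear koszul f 0%N -> qring f} := koszul_aug_fun.

Theorem koszul_resolution : regular_seq f -> resolution koszul_aug.
Proof.
move=> reg; have takef : take s f = f by rewrite take_oversize // size_tuple.
have exact i (x : kobj R s i) : (forall B, ext_diff (ext_of x) B = 0) ->
    ideal f (ext_of x set0) -> exists y : kobj R s i.+1, x = kdiff f i y.
  rewrite -{1}takef => dx Ix.
  (* [y] may be inhomogeneous; its part of degree [i.+1] already has boundary [x]. *)
  have [y _ yE] := ext_exact reg (leqnn s) (@ext_low_size _) dx Ix.
  exists (ext_part i.+1 y); rewrite kdiff_part -[LHS]ext_ofK.
  by apply/ffunP => A; rewrite !ffunE yE.
have set0E (x : kobj R s 0) : x ksub0 = ext_of x set0.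
  by rewrite -{1}(ext_ofK x) ffunE SubK.
split=> [|x|n x dx].
- by elim/qringW=> r; exists [ffun=> r]; rewrite /koszul_aug /= /koszul_aug_fun ffunE.
- split=> [/ideal_qring|[y ->]].
    rewrite set0E; apply: exact => B; apply: big1 => a aB.
    by rewrite ext_of_out ?mulr0 // cardsU1 aB.
  apply/ideal_qring; rewrite -(ext_ofK y) kdiff_part ffunE SubK -takef.
  exact/ext_diff_ideal/ext_low_size.
- apply: exact; first exact: ext_diff_of.
  by rewrite ext_of_out ?cards0 //; apply: ideal0.
Qed.

Lemma flat_koszul n : flat (koszul f n).
Proof. exact: flat_ffun. Qed.
End Exterior.

(** * Regularity of the period sequence *)

Section GroupAlgebraTheory.
Variables (k : comNzRingType) (G : zmodType).
Local Notation mon g := (<< g >> : gralg k G).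
Implicit Types (g h v : G) (x y : gralg k G) (l : seq (gralg k G)).

Lemma gralgU_mul g h : mon g * mon h = mon (g + h).
Proof. exact: gralg_mulUU. Qed.

Lemma gralgMDr (a : k) x y z : x * (a *: y + z) = a *: (x * y) + x * z.
Proof. exact: gralg_mulPr. Qed.

Lemma gralgU_exp g n : mon g ^+ n = mon (g *+ n).
Proof. by elim: n => // n IH; rewrite exprS IH gralgU_mul mulrS. Qed.

Lemma coeff_gralgU_mul v g x : coeff (v + g) (mon v * x) = coeff g x.
Proof.
elim/free_ind: x => [|a h x IH]; first by rewrite mulr0 !coeff0.
rewrite gralgMDr gralgU_mul !coeffD !coeffZ IH !coeffU.
by rewrite (inj_eq (addrI v)).
Qed.

(** Coefficients of [x] are constant along the infinite orbits of translation by [v], while the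
    support is finite. *)
Lemma gralgU_mul_fixed v x :
  (forall n, v *+ n = 0 -> n = 0%N) -> mon v * x = x -> x = 0.
Proof.
move=> vtf vx.
have coeffE g n : coeff (v *+ n + g) x = coeff g x.
  elim: n => [|n IH]; first by rewrite mulr0n add0r.
  by rewrite mulrS -addrA -{1}vx coeff_gralgU_mul.
apply/eqP/freeg_eqP => g; rewrite coeff0; apply/eqP; apply: contraT => xg.
have vI : injective (fun n => v *+ n + g).
  have le n m : v *+ n + g = v *+ m + g -> (n <= m)%N -> n = m.
    move=> /addIr e /subnK mE; move: e; rewrite -mE mulrnDr.
    move=> /esym/eqP; rewrite -subr_eq0 addrK => /eqP/vtf ->.
    by rewrite add0n.
  move=> n m e; case: (leqP n m) => [/(le _ _ e)//|/ltnW/(le m n (esym e))].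
  by move->.
set t := [seq v *+ n + g | n <- iota 0 (size (dom x)).+1].
have ut : uniq t by rewrite map_inj_uniq ?iota_uniq.
have /(uniq_leq_size ut) : {subset t <= dom x}.
  by move=> _ /mapP[n _ ->]; rewrite mem_dom coeffE.
by rewrite size_map size_iota ltnn.
Qed.

Lemma ideal_gralgU l v g q :
  ideal l (mon v - 1) -> ideal l (mon (v *~ q + g) - mon g).
Proof.
move=> lv; have nat_case n h : ideal l (mon (v *+ n + h) - mon h).
  elim: n => [|n IH]; first by rewrite mulr0n add0r subrr; apply: ideal0.
  rewrite mulrS -addrA -(subrK (mon (v *+ n + h)) (mon (v + _))) -addrA.
  apply: idealD IH; set y := mon (_ + h).
  have -> : mon (v + (v *+ n + h)) - y = y * (mon v - 1).
    by rewrite mulrBr mulr1 mulrC gralgU_mul.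
  exact: idealMl.
case: q => n; first exact: nat_case.
(* A negative multiple is the positive case started from the translated exponent, with the ends
   exchanged. *)
rewrite NegzE mulrNz -opprB; apply: idealN.
by have := nat_case n.+1 (- (v *+ n.+1) + g); rewrite addrA subrr add0r.
Qed.
End GroupAlgebraTheory.

Section Period.
Variables (N D : nat) (L : 'I_D -> nat).
Local Notation G := {ffun 'I_D -> int}.
Local Notation b := (period N L).
Implicit Types (g h : G) (i : 'I_D) (x r : laurent N D).

Definition cycle i : G := [ffun j : 'I_D => (j == i)%:Z] *+ L i.

Lemma cycleE i j : cycle i j = if j == i then (L i)%:Z else 0.
Proof. by rewrite /cycle ffunMnE ffunE; case: eqP => _; rewrite ?mul0rn -?pmulrn ?natz. Qed.

Lemma tnth_period i : tnth b i = (<< cycle i >> : laurent N D) - 1.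
Proof. by rewrite tnth_mktuple gralgU_exp. Qed.

Definition exp_mod m g : G :=
  [ffun j : 'I_D => if (j < m)%N then (g j %% L j)%Z else g j].

Lemma exp_mod_cycle m i g : exp_mod m (cycle i + g) =
  if (i < m)%N then exp_mod m g else cycle i + exp_mod m g.
Proof.
apply/ffunP => j; case: ifPn => im; rewrite !ffunE cycleE.
  case: eqP => [->|]; last by rewrite add0r.
  by rewrite im modzDl.
by case: eqP => [->|]; rewrite ?add0r // (negPf im).
Qed.

Local Notation mon g := (<< g >> : laurent N D).

(** Normal form modulo the first [m] entries of [b]. It is only ['Z_N]-linear; its behaviour under
    multiplication by [x_i^(L_i)] is [red_cycle]. *)
Definition red m : {linear gralg 'Z_N G -> gralg 'Z_N G} :=
  fglift (fun g => mon (exp_mod m g)).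

Lemma redU m g : red m (mon g) = mon (exp_mod m g).
Proof. exact: fgliftU. Qed.

Lemma red_cycle m i x : red m (mon (cycle i) * x) =
  if (i < m)%N then red m x else mon (cycle i) * red m x.
Proof.
elim/free_ind: x => [|a g x IH].
  by rewrite mulr0 linear0 mulr0; case: ifP.
rewrite gralgMDr gralgU_mul !linearP IH !redU exp_mod_cycle.
by case: ifP => // _; rewrite gralgMDr gralgU_mul.
Qed.

Lemma red_ideal m r : ideal (take m b) r -> red m r = 0.
Proof.
elim=> [|a x y bx _ IH]; first exact: linear0.
rewrite linearD IH addr0; move: (bx); rewrite -index_mem size_take size_tuple => xm.
have xD : (index x (take m b) < D)%N.
  by apply: leq_trans xm _; case: ltnP => [/ltnW|] //.
have xm' : (index x (take m b) < m)%N by apply: leq_trans xm _; case: ltnP.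
have -> : x = tnth b (Ordinal xD).
  by rewrite (tnth_nth 0) /= -(nth_take 0 xm') nth_index.
rewrite tnth_period -[_ *: _]/(a * _) mulrBr mulr1 linearB mulrC red_cycle /=.
by rewrite xm' subrr.
Qed.

Lemma ideal_exp_mod m g : (m <= D)%N ->
  ideal (take m b) (mon g - mon (exp_mod m g)).
Proof.
elim: m => [|m IH] mD.
  have -> : exp_mod 0 g = g by apply/ffunP => j; rewrite ffunE.
  by rewrite subrr; apply: ideal0.
rewrite -(subrK (mon (exp_mod m g)) (mon g)) -addrA; apply: idealD.
  apply: sub_ideal (IH (ltnW mD)) => x; rewrite -(@take_takel _ m m.+1 b) //.
  exact: mem_take.
pose i := Ordinal mD.
have -> : exp_mod m g = cycle i *~ (g i %/ L i)%Z + exp_mod m.+1 g.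
  apply/ffunP => j; rewrite !ffunE.
  have -> (q : int) : (cycle i *~ q) j = cycle i j *~ q.
    by case: q => n; rewrite ?NegzE ?mulrNz ?ffunE -?pmulrn ffunMnE.
  rewrite cycleE; have [->|ji] := eqVneq j i.
    by rewrite /= ltnn leqnn mulrzz mulrC -divz_eq.
  rewrite mul0rz add0r ltnS [(j <= m)%N]leq_eqVlt.
  by have /negPf -> : (j : nat) != m by rewrite -[m]/(val i) val_eqE.
apply: ideal_gralgU; rewrite -tnth_period; exact/ideal_gen/mem_take_tnth.
Qed.

Lemma ideal_red m r : (m <= D)%N -> ideal (take m b) (r - red m r).
Proof.
move=> mD; elim/free_ind: r => [|a g r IH].
  by rewrite linear0 subrr; apply: ideal0.
rewrite linearP redU opprD addrACA -scalerBr; apply: idealD IH.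
(* The scalar [a] lies in ['Z_N]; as a constant Laurent polynomial it acts on the ideal. *)
have -> (y : laurent N D) : a *: y = (a *: mon 0 : laurent N D) * y.
  by rewrite -[a *: mon 0]addr0 mulrC gralgMDr mulr0 addr0 mulrC mul1r.
exact/idealMl/ideal_exp_mod.
Qed.

Hypothesis L_gt0 : forall i, (0 < L i)%N.

(* red m has kernel the ideal of the first m entries, and maps R / (b_1 .. b_m) *)
(* onto the span of reduced monomials, on which x_i ^+ L i, i >= m, has         *)
(* infinite orbits.                                                             *)
Lemma regular_period : regular_seq b.
Proof.
apply/regular_seqP => i r; rewrite tnth_period mulrBl mul1r => /red_ideal.
rewrite linearB red_cycle ltnn => /eqP; rewrite subr_eq0 => /eqP fix_r.
(* [fix_r] forces [red i r = 0], so [r] equals [r - red i r], which lies in the ideal. *)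
rewrite -[r]subr0 -[X in _ - X](gralgU_mul_fixed _ fix_r).
  exact/ideal_red/ltnW.
move=> n /ffunP/(_ i); rewrite ffunMnE cycleE eqxx ffunE.
move/eqP; rewrite Num.Theory.mulrn_eq0 => /orP[/eqP //|].
by rewrite -[_ == _]/(L i == 0%N) eqn0Ngt L_gt0.
Qed.
End Period.

Local Close Scope ring_scope.

(** * The two isomorphisms *)

Theorem fact4 (N D s : nat) (f : s.-tuple (laurent N D)) (L : 'I_D -> nat)
    (j : nat) (hN : 1 < N) (hf : regular_seq f) (hL : forall i, 0 < L i)
    (hj : j <= s) :
  let b := period N L in
  exists (hZ : annihilated b (logicalZ f L j))
         (hT : annihilated b (Tor j (qring b) (qring f)))
         (hK : annihilated b (homology (koszul_with b (qring f)) j)),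
    isom (R := qring b) (annmod hZ) (annmod hT) /\
    isom (R := qring b) (annmod hT) (annmod hK).
Proof.
move=> b; have resf := koszul_resolution hf.
have resb := koszul_resolution (regular_period (N := N) hL).
have isoTZ : isom (Tor j (qring b) (qring f)) (logicalZ f L j).
  apply: (isom_homology_balance (free_res_resolution (qring b)) resf).
    exact: flat_free_res.
  exact: flat_koszul.
have isoKZ : isom (homology (koszul_with b (qring f)) j) (logicalZ f L j).
  by apply: (isom_homology_balance resb resf); apply: flat_koszul.
have isoZT := isom_sym isoTZ; have isoTK := isom_trans isoTZ (isom_sym isoKZ).
have hZ : annihilated b (logicalZ f L j).
  exact/annihilated_tens_homology/annihilated_qring.
(* Annihilation by [b] is evident for coefficients in [R/(b)] and is carried to the other two
   modules by the isomorphisms. *)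
have hT := annihilated_isom isoZT hZ; have hK := annihilated_isom isoTK hT.
exists hZ, hT, hK; split.
  exact (isom_annmod hZ hT isoZT).
exact (isom_annmod hT hK isoTK).
Qed.
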